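(* Fix constants $C>1$ and $\gamma>0$. Let $(G_n)$ be a sequence of graphs, where $G=G_n$ has $n$ vertices, average degree $\bar d=\bar d(G_n)\ge 1$, $m=\frac{n\bar d}{2}$ edges and maximum degree $\Delta(G_n)$. Let $L=\{v\in V(G): d_v< C\bar d\}$ and assume that for every $n$ $$\mathrm{vol}(L)\ \ge\ (1+\gamma)m=(1+\gamma)\frac{n\bar d}{2}.$$ If $\Delta(G_n)\,n^{-1}=o(1)$ and $\bar d^{\,10}n^{-1}=o(1)$ as $n\to\infty$, then $$q^*(G)\ \ge\ \frac{0.26\,\gamma}{\sqrt{C\bar d}}\,(1+o(1)),$$ where the $o(1)$ term tends to $0$ as $n\to\infty$.
   Context: Graphs are finite and simple. $d_v$ is the degree of $v$, and for a vertex set $A$, $\mathrm{vol}(A)=\sum_{v\in A}d_v$ and $e(A)$ is the number of edges with both endpoints in $A$. For a graph $G$ with $m\ge 1$ edges and a partition $\mathcal A$ of $V(G)$, the modularity score is $q_{\mathcal A}(G)=\sum_{A\in\mathcal A}\left(\frac{e(A)}{m}-\left(\frac{\mathrm{vol}(A)}{2m}\right)^2\right)$, and the modularity of $G$ is $q^*(G)=\max_{\mathcal A}q_{\mathcal A}(G)$ over all partitions $\mathcal A$ of $V(G)$. All asymptotic notation is with respect to $n\to\infty$. *)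

(* Defs.v *)
From HB Require Import structures.
From mathcomp Require Import all_boot all_order all_algebra.
From mathcomp Require Import all_classical all_reals all_analysis.

Set Implicit Arguments.
Unset Strict Implicit.
Unset Printing Implicit Defensive.

Import Order.TTheory GRing.Theory Num.Theory.
Import numFieldNormedType.Exports.

Local Open Scope ring_scope.

Record sgraph (V : finType) := SGraph {
  adj : rel V;
  adj_sym : symmetric adj;
  adj_irrefl : irreflexive adj
}.

Section Graph.
Variables (V : finType) (G : sgraph V).

Definition edges : {set {set V}} :=
  [set [set p.1; p.2] | p : V * V & adj G p.1 p.2].

Definition num_edges : nat := #|edges|.

Definition deg (v : V) : nat := #|[set w | adj G v w]|.

Definition max_deg : nat := (\max_(v : V) deg v)%N.

Definition vol (A : {set V}) : nat := (\sum_(v in A) deg v)%N.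

Definition edges_in (A : {set V}) : nat := #|[set E in edges | E \subset A]|.

End Graph.

Section Modularity.
Variables (R : realType) (V : finType) (G : sgraph V).

Definition avg_deg : R := (\sum_(v : V) deg G v)%N%:R / #|V|%:R.

Definition low_deg (C : R) : {set V} := [set v | (deg G v)%:R < C * avg_deg].

Definition mod_score (P : {set {set V}}) : R :=
  let m : R := (num_edges G)%:R in
  \sum_(A in P)
     ((edges_in G A)%:R / m - ((vol G A)%:R / (2 * m)) ^+ 2).

Definition singletons : {set {set V}} := [set [set v] | v : V].

(* Maximum over all partitions; the base value of the iterated maximum is the
   score of an actual partition, so that it does not affect the result. *)
Definition modularity : R :=
  \big[Num.max/mod_score singletons]_(P : {set {set V}} | finset.partition P [set: V])
     mod_score P.

Lemma singletons_partition : finset.partition singletons [set: V].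
Proof.
apply/and3P; split.
- apply/eqP/setP=> v; rewrite inE; apply/bigcupP; exists [set v].
    exact: imset_f.
  by rewrite inE.
- apply/finset.trivIsetP=> _ _ /imsetP[u _ ->] /imsetP[v _ ->] uv.
  rewrite disjoints1 inE; by apply: contraNneq uv => ->.
- by apply/imsetP=> -[v _ /setP /(_ v)]; rewrite !inE eqxx.
Qed.

Lemma modularity_ge (P : {set {set V}}) :
  finset.partition P [set: V] -> mod_score P <= modularity.
Proof. by move=> pP; rewrite /modularity (bigD1 P) //= le_max lexx. Qed.

Lemma modularity_attained :
  exists2 P : {set {set V}}, finset.partition P [set: V] & modularity = mod_score P.
Proof.
rewrite /modularity.
elim/big_rec: _ => [|P x pP [Q pQ ->]].
  by exists singletons => //; exact: singletons_partition.
by rewrite /Num.max; case: ifP => _; [exists Q | exists P].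
Qed.

End Modularity.

Arguments avg_deg R {V} G.
Arguments modularity R {V} G.

(* Main.v *)
(* A sign vector x on the vertices gives a bipartition of score
   (x^T A x - (d.x)^2 / 2m) / 4m, where A is the adjacency matrix and d the degree
   vector. The hypothesis on vol(L) forces at least gamma m edges inside L, so it is
   enough to find random values y_v in [-1, 1], zero off L, such that E[y_u y_v] is at
   least 0.52 / sqrt(C d) on every edge inside L while d.y has small variance; the y_v
   are then rounded to signs, since the off-diagonal quadratic form is affine in each
   coordinate.

   Let N be the maximum degree inside L, and take independent uniform signs x_v. Put
   y_v = clip (x_v + S_v / sqrt N), where S_v is the sum of x over the neighbours of v in
   L, padded to N terms. On an edge uv, Harris' inequality conditionally on (x_u, x_v)
   disposes of the common neighbours and leaves E[y_u y_v] >= 2 p q, where p and q are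
   the correlations of y_u with x_u and with x_v. With T = S_N / sqrt N, the inequalities
   E|T| <= sqrt 3 / 2 (for N >= 2) and E T^6 <= 15 give p >= 0.565 and
   q >= 0.461 / sqrt N. For N <= 1 the edges inside L form a matching, and both ends of an
   edge copy one sign. The variance of d.y is bounded by the Efron-Stein inequality. *)

Require Import Defs.
From HB Require Import structures.
From mathcomp Require Import all_boot all_order all_algebra.
From mathcomp Require Import all_classical all_reals all_analysis.
From mathcomp Require Import ring lra zify.

Set Implicit Arguments.
Unset Strict Implicit.
Unset Printing Implicit Defensive.

Import Order.TTheory GRing.Theory Num.Theory.
Import numFieldNormedType.Exports.

Local Open Scope ring_scope.

(** * Averages over independent uniform signs: correlation and variance inequalities *)

Section SignAverage.
Variables (R : realType) (V : eqType).
Implicit Types (x y : V -> R) (f g : (V -> R) -> R) (s : seq V).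

Definition upd x (v : V) (t : R) : V -> R := fun w => if w == v then t else x w.

(* The expectation of [f] when the coordinates of [x] in [s] are replaced by
   independent uniform signs. *)
Fixpoint avg s f x : R :=
  if s is v :: s' then (avg s' f (upd x v 1) + avg s' f (upd x v (-1))) / 2
  else f x.

Definition pointwise_mono f := forall x y, (forall v, x v <= y v) -> f x <= f y.

Lemma updC x u v a b : u != v -> upd (upd x u a) v b = upd (upd x v b) u a.
Proof.
move=> uv; apply/funext => w; rewrite /upd.
by case: eqP => // ->; rewrite eq_sym (negbTE uv).
Qed.

Lemma upd_le x y v t : (forall w, x w <= y w) ->
  forall w, upd x v t w <= upd y v t w.
Proof. by move=> xy w; rewrite /upd; case: eqP. Qed.

Lemma updN x v t : upd (fun w => - x w) v (- t) = (fun w => - upd x v t w).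
Proof. by apply/funext => w; rewrite /upd; case: eqP. Qed.

Lemma avg_cst s (c : R) x : avg s (fun=> c) x = c.
Proof. by elim: s x => //= v s IH x; rewrite !IH; field. Qed.

Lemma avgD s f g x : avg s (fun y => f y + g y) x = avg s f x + avg s g x.
Proof. by elim: s x => //= v s IH x; rewrite !IH; field. Qed.

Lemma avgZ s f c x : avg s (fun y => c * f y) x = c * avg s f x.
Proof. by elim: s x => //= v s IH x; rewrite !IH; field. Qed.

Lemma avg_sum (I : Type) (r : seq I) (P : pred I) (F : I -> (V -> R) -> R) s x :
  avg s (fun y => \sum_(i <- r | P i) F i y) x = \sum_(i <- r | P i) avg s (F i) x.
Proof.
elim: s x => //= v s IH x; rewrite !IH mulrDl !big_distrl /= -big_split /=.
by apply: eq_bigr => i _; rewrite mulrDl.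
Qed.

Lemma avg_attained s f x : exists y, avg s f x <= f y.
Proof.
elim: s x => [|v s IH] x /=; first by exists x.
have [y1 h1] := IH (upd x v 1); have [y2 h2] := IH (upd x v (-1)).
have [h|h] := lerP (f y1) (f y2); [exists y2 | exists y1]; lra.
Qed.

Lemma avg_rem s f x u : u \in s -> avg s f x = avg (u :: rem u s) f x.
Proof.
elim: s x => //= v s IH x; rewrite inE eq_sym; case: (eqVneq v u) => [->//|vu] /= us.
rewrite !(IH _ us) /= !(updC _ _ _ vu).
by field.
Qed.

Lemma avg_mono s f : pointwise_mono f -> pointwise_mono (avg s f).
Proof.
move=> mf; elim: s => //= v s IH x y xy.
by rewrite ler_pM2r ?lerD //; apply: IH; apply: upd_le.
Qed.

Lemma upd_mono x v : forall w, upd x v (-1) w <= upd x v 1 w.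
Proof. by move=> w; rewrite /upd; case: eqP => // _; lra. Qed.

(** Induction on the coordinates: the averages over the remaining signs are again monotone, so
    Chebyshev's sum inequality applies to the two values of one sign. *)
Lemma harris s f g x : pointwise_mono f -> pointwise_mono g ->
  avg s f x * avg s g x <= avg s (fun y => f y * g y) x.
Proof.
move=> mf mg; elim: s x => //= v s IH x.
have := IH (upd x v 1); have := IH (upd x v (-1)).
have := avg_mono s mf (upd_mono x v).
have := avg_mono s mg (upd_mono x v).
by nra.
Qed.

Lemma avg_odd s f x : (forall y, f (fun v => - y v) = - f y) ->
  avg s f (fun v => - x v) = - avg s f x.
Proof.
move=> fN; elim: s x => //= v s IH x.
have h1 := updN x v 1; have := updN x v (-1); rewrite opprK => h2.
by rewrite h1 h2 !IH; field.
Qed.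

Lemma avg_odd0 s f : (forall y, f (fun v => - y v) = - f y) -> avg s f (fun=> 0) = 0.
Proof.
move=> fN; have := avg_odd s (fun=> 0) fN; rewrite oppr0 => h; lra.
Qed.

Lemma avg_diff s f v c x : v \notin s ->
  (forall y, `|f (upd y v 1) - f (upd y v (-1))| <= c) ->
  `|avg s f (upd x v 1) - avg s f (upd x v (-1))| <= c.
Proof.
move=> + fc; elim: s x => //= w s IH x; rewrite inE negb_or => /andP[vw vs].
have := IH (upd x w 1) vs; have := IH (upd x w (-1)) vs.
by rewrite !(updC _ _ _ vw) !ler_norml; lra.
Qed.

(** For the conditional means a, b given one sign, (a^2 + b^2)/2 = ((a + b)/2)^2 + ((a - b)/2)^2,
    and [avg_diff] bounds the last term by [c v ^+ 2 / 4]. *)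
Lemma efron_stein s f (c : V -> R) x : uniq s ->
  (forall v y, v \in s -> `|f (upd y v 1) - f (upd y v (-1))| <= c v) ->
  avg s (fun y => f y ^+ 2) x <= avg s f x ^+ 2 + \sum_(v <- s) c v ^+ 2 / 4.
Proof.
elim: s x => [|v s IH] x /=; first by rewrite big_nil addr0.
move=> /andP[vs us] fc; rewrite big_cons.
have fcs w y : w \in s -> `|f (upd y w 1) - f (upd y w (-1))| <= c w.
  by move=> ws; apply: fc; rewrite inE ws orbT.
have h1 := IH (upd x v 1) us fcs; have h2 := IH (upd x v (-1)) us fcs.
have := avg_diff x vs (fun y => fc v y (mem_head _ _)).
rewrite -ler_sqr ?nnegrE //; last exact: le_trans (fc v x (mem_head _ _)).
rewrite real_normK ?num_real // => h3.
by move: h1 h2 h3; rewrite !expr2; set S := \sum_(_ <- _) _; lra.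
Qed.

End SignAverage.

(** * Moments of the simple symmetric random walk *)

Section RandomWalk.
Variable R : realType.
Implicit Types (f g : R -> R) (z : R).

(* The expectation of [f (S_n)], with [S_n] the simple symmetric random walk. *)
Fixpoint walk (n : nat) f : R :=
  if n is n'.+1 then (walk n' (fun z => f (z + 1)) + walk n' (fun z => f (z - 1))) / 2
  else f 0.

(** After [n] steps the walk has the parity of [n]; the exact recursions for the mean absolute value
    rest on this. *)
Lemma eq_walk_lattice n f g :
  (forall j : nat, f (n%:R - 2 * j%:R) = g (n%:R - 2 * j%:R)) -> walk n f = walk n g.
Proof.
elim: n f g => [|n IH] f g fg /=; first by have := fg 0%N; rewrite mulr0 subr0.
congr ((_ + _) / _); apply: IH => j.
  by have := fg j; congr (f _ = g _); rewrite -natr1; ring.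
by have := fg j.+1; congr (f _ = g _); rewrite -!natr1; ring.
Qed.

Lemma eq_walk n f g : f =1 g -> walk n f = walk n g.
Proof. by move=> fg; apply: eq_walk_lattice => j. Qed.

Lemma le_walk n f g : (forall z, f z <= g z) -> walk n f <= walk n g.
Proof.
by elim: n f g => [|n IH] f g fg //=; rewrite ler_pM2r // lerD // IH.
Qed.

Lemma walk_cst n c : walk n (fun=> c) = c.
Proof. by elim: n => //= n ->; field. Qed.

Lemma walkD n f g : walk n (fun z => f z + g z) = walk n f + walk n g.
Proof. by elim: n f g => //= n IH f g; rewrite !IH; field. Qed.

Lemma walkZ n f c : walk n (fun z => c * f z) = c * walk n f.
Proof. by elim: n f => //= n IH f; rewrite !IH; field. Qed.

Lemma walkN n f : walk n (fun z => - f z) = - walk n f.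
Proof. by elim: n f => //= n IH f; rewrite !IH; field. Qed.

Lemma walk_sym n f : walk n (fun z => f (- z)) = walk n f.
Proof.
elim: n f => [|n IH] f /=; first by rewrite oppr0.
rewrite -(IH (fun z => f (z + 1))) -(IH (fun z => f (z - 1))) addrC.
by congr ((_ + _) / _); apply: eq_walk => z; rewrite opprD ?opprK.
Qed.

Lemma walk_walk k j f : walk k (fun z => walk j (fun t => f (z + t))) = walk (k + j) f.
Proof.
elim: k f => [|k IH] f /=; first by apply: eq_walk => z; rewrite add0r.
rewrite -!IH; congr ((_ + _) / _);
  by do 2![apply: eq_walk => ?]; rewrite addrAC.
Qed.

Lemma walkS n f :
  walk n.+1 f = (walk n (fun z => f (z + 1)) + walk n (fun z => f (z - 1))) / 2.
Proof. by []. Qed.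

Lemma walk_half_diff n f g :
  walk n (fun z => (f z - g z) / 2) = (walk n f - walk n g) / 2.
Proof.
rewrite -walkN -walkD mulrC -walkZ; apply: eq_walk => z.
by rewrite mulrC.
Qed.

(** Discrete integration by parts: each step X_i contributes the same E[X_i f(S)], and averaging
    over X_i alone leaves the half difference of [f]. *)
Lemma walk_stein n f :
  walk n.+1 (fun z => z * f z) = n.+1%:R * walk n (fun z => (f (z + 1) - f (z - 1)) / 2).
Proof.
elim: n f => [|n IH] f; first by rewrite /= !add0r; field.
(* The induction hypothesis shifted by [a]; the values 1 and -1 are the outcomes of one extra
   step. *)
have e a : walk n.+1 (fun z => (z + a) * f (z + a))
         = n.+1%:R * walk n (fun z => (f (z + 1 + a) - f (z - 1 + a)) / 2)
           + a * walk n.+1 (fun z => f (z + a)).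
  by rewrite -(IH (fun z => f (z + a))) -walkZ -walkD; apply: eq_walk => z; ring.
rewrite (walkS n.+1 (fun z => z * f z)) (e 1) (e (-1)) !walk_half_diff !walkS.
have -> : walk n (fun z => f (z - 1 + 1)) = walk n (fun z => f (z + 1 - 1)).
  by apply: eq_walk => z; rewrite addrAC.
by rewrite -[n.+2%:R]natr1 -[n.+1%:R]natr1; field.
Qed.

Lemma walk_sqr n : walk n (fun z => z ^+ 2) = n%:R.
Proof.
case: n => [|n]; first by rewrite /= expr0n.
rewrite (walk_stein n (fun z => z)) (@eq_walk _ _ (fun=> 1)) ?walk_cst ?mulr1 //.
by move=> z; field.
Qed.

(** [walk_stein] applied to a power reduces to lower moments; 3 here and 15 in [walk_exp6] are the
    Gaussian moments. *)
Lemma walk_exp4 n : walk n (fun z => z ^+ 4) <= 3 * n%:R ^+ 2.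
Proof.
case: n => [|n]; first by rewrite /= !expr0n mulr0.
rewrite (@eq_walk _ _ (fun z => z * z ^+ 3)); last by move=> z; rewrite -exprS.
rewrite (walk_stein n (fun z => z ^+ 3)).
rewrite (@eq_walk _ _ (fun z => 3 * z ^+ 2 + 1)); last by move=> z; field.
rewrite walkD walkZ walk_sqr walk_cst -[n.+1%:R]natr1.
have : 0 <= n%:R :> R by [].
by nra.
Qed.

Lemma walk_exp6 n : walk n (fun z => z ^+ 6) <= 15 * n%:R ^+ 3.
Proof.
case: n => [|n]; first by rewrite /= !expr0n mulr0.
rewrite (@eq_walk _ _ (fun z => z * z ^+ 5)); last by move=> z; rewrite -exprS.
rewrite (walk_stein n (fun z => z ^+ 5)).
rewrite (@eq_walk _ _ (fun z => (5 * z ^+ 4 + 10 * z ^+ 2) + 1)); last by move=> z; field.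
rewrite !walkD !walkZ walk_sqr walk_cst -[n.+1%:R]natr1.
have n0 : 0 <= n%:R :> R by [].
have := walk_exp4 n; set w := walk n _ => hw.
have : 5 * w + 10 * n%:R + 1 <= 15 * (n%:R + 1) ^+ 2 by nra.
move/(ler_wpM2l (_ : 0 <= n%:R + 1)) => /(_ ltac:(lra)) /le_trans; apply.
by lra.
Qed.

Lemma walk_normS n :
  walk n.+1 Num.norm = walk n (fun z => (`|z + 1| + `|z - 1|) / 2).
Proof.
rewrite walkS -walkD mulrC -walkZ; apply: eq_walk => z.
by rewrite mulrC.
Qed.

(** At an odd time the walk is at a nonzero integer, from where one step preserves the absolute
    value on average. *)
Lemma walk_norm_odd n : odd n -> walk n.+1 Num.norm = walk n Num.norm.
Proof.
move=> on; rewrite walk_normS; apply: eq_walk_lattice => j.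
have -> : n%:R - 2 * j%:R = 1 + 2 * (n./2%:R - j%:R) :> R.
  by rewrite -{1}(odd_double_half n) on -muln2 natrD natrM /=; ring.
have [h|h] := leqP j n./2.
  have : j%:R <= n./2%:R :> R by rewrite ler_nat.
  by move=> h'; rewrite !ger0_norm; lra.
have : j.-1.+1%:R = j%:R :> R by rewrite prednK //; lia.
have : n./2%:R <= j.-1%:R :> R by rewrite ler_nat; lia.
by rewrite -natr1 => h1 h2; rewrite !ler0_norm; lra.
Qed.

(** Let p be the probability of being at 0 after [n] steps. Stein's identity for the sign gives
    E|S_{n+1}| = (n+1) p, the one-step increment gives E|S_{n+1}| - E|S_n| = p, and p is
    eliminated. *)
Lemma walk_norm_even n : ~~ odd n ->
  n%:R * walk n.+1 Num.norm = n.+1%:R * walk n Num.norm.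
Proof.
move=> on.
have e2 : walk n.+1 Num.norm
        = n.+1%:R * walk n (fun z => (Num.sg (z + 1) - Num.sg (z - 1)) / 2).
  rewrite -(walk_stein n Num.sg); apply: eq_walk => z.
  by rewrite mulrC -normrEsg.
(* On even integers both integrands are the indicator of 0. *)
have e3 : walk n (fun z => (Num.sg (z + 1) - Num.sg (z - 1)) / 2)
        = walk n (fun z => (`|z + 1| + `|z - 1|) / 2 - `|z|).
  apply: eq_walk_lattice => j.
  have -> : n%:R - 2 * j%:R = 2 * (n./2%:R - j%:R) :> R.
    by rewrite -{1}(odd_double_half n) (negbTE on) -muln2 natrD natrM /=; ring.
  case: (ltngtP j n./2) => h; last first.
  - by rewrite h subrr mulr0 add0r sub0r sgrN sgr1 normrN normr0 normr1; field.
  - have : n./2.+1%:R <= j%:R :> R by rewrite ler_nat.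
    rewrite -natr1 => h1.
    by rewrite !ler0_norm ?ltr0_sg; lra.
  - have : j.+1%:R <= n./2%:R :> R by rewrite ler_nat.
    rewrite -natr1 => h1.
    by rewrite !ger0_norm ?gtr0_sg; lra.
have e4 : walk n (fun z => (`|z + 1| + `|z - 1|) / 2 - `|z|)
        = walk n.+1 Num.norm - walk n Num.norm.
  by rewrite walk_normS -walkN -walkD.
move: e2; rewrite e3 e4 -[n.+1%:R]natr1 => e2.
lra.
Qed.

Lemma walk_norm_ge0 n : 0 <= walk n Num.norm.
Proof. by rewrite -(walk_cst n 0); apply: le_walk. Qed.

Lemma walk_norm2 : walk 2 Num.norm = 1.
Proof. by rewrite walk_norm_odd //= add0r sub0r normrN normr1; field. Qed.

(** Equality holds at time 3. With k = 2m, an induction step multiplies the square by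
    ((k+5)/(k+4))^2, which is at most (k+5)/(k+3). *)
Lemma walk_norm_oddE m : walk m.*2.+3 Num.norm ^+ 2 <= 3 / 4 * m.*2.+3%:R.
Proof.
elim: m => [|m IH].
  have h := @walk_norm_even 2 isT; rewrite walk_norm2 in h.
  by rewrite (_ : walk _ _ = 3 / 2) ?double0; lra.
have h := walk_norm_even (n := m.*2.+4) ltac:(by rewrite /= odd_double).
have h' := walk_norm_odd (n := m.*2.+3) ltac:(by rewrite /= odd_double).
rewrite doubleS; move: h; rewrite h'.
set a := walk m.*2.+3 _ in IH *; set b := walk _ _ => h.
have p1 : m.*2.+3%:R = m.*2%:R + 3 :> R by rewrite -addn3 natrD.
have p2 : m.*2.+4%:R = m.*2%:R + 4 :> R by rewrite -addn4 natrD.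
have p3 : m.*2.+2.+3%:R = m.*2%:R + 5 :> R by rewrite -(natrD _ _ 5) !addnS addn0.
move: h IH; rewrite p1 p2 p3 => h IH.
have k0 : 0 <= m.*2%:R :> R by [].
set k := m.*2%:R in h IH k0 *.
have hb : b = (k + 5) / (k + 4) * a by rewrite mulrAC -h; field; lra.
rewrite hb exprMn.
apply: (@le_trans _ _ (((k + 5) / (k + 4)) ^+ 2 * (3 / 4 * (k + 3)))).
  by rewrite ler_wpM2l // sqr_ge0.
rewrite expr_div_n mulrAC ler_pdivrMr; last by rewrite exprn_gt0 //; lra.
have : (k + 5) * (k + 3) <= (k + 4) ^+ 2 by nra.
move/(ler_wpM2l (_ : 0 <= 3 / 4 * (k + 5))) => /(_ ltac:(lra)).
by lra.
Qed.

(** An even time beyond 2 inherits the value of the odd time before it. At time 1 the mean is 1 and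
    the bound fails. *)
Lemma walk_norm_le n : (2 <= n)%N -> walk n Num.norm ^+ 2 <= 3 / 4 * n%:R.
Proof.
case: n => [|[|[|n]]] // _.
  by rewrite walk_norm2; lra.
rewrite -(odd_double_half n); case: odd; rewrite ?add1n ?add0n.
  rewrite walk_norm_odd; last by rewrite oddS oddS oddS odd_double.
  apply: le_trans (walk_norm_oddE _) _.
  by rewrite ler_wpM2l ?ler_nat //; lra.
exact: walk_norm_oddE.
Qed.

End RandomWalk.

(** * Truncation to [-1, 1] and the correlation constant 0.52 *)

Section Clip.
Variable R : realType.
Implicit Types (t z : R).

Definition clip t : R := Num.max (-1) (Num.min 1 t).

Lemma clipE t : [\/ t <= -1 /\ clip t = -1, -1 <= t <= 1 /\ clip t = t
                   | 1 <= t /\ clip t = 1].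
Proof.
rewrite /clip; have [h|h] := lerP 1 t.
  by constructor 3; rewrite max_r //; lra.
have [h'|h'] := lerP (-1) t; first by constructor 2; split => //; lra.
by constructor 1; split => //; lra.
Qed.

Lemma clipN t : clip (- t) = - clip t.
Proof. by case: (clipE t) (clipE (- t)) => -[h1 ->] [] [h2 ->]; lra. Qed.

Lemma le_clip t z : t <= z -> clip t <= clip z.
Proof. by case: (clipE t) (clipE z) => -[h1 ->] [] [h2 ->]; lra. Qed.

Lemma norm_clip t : `|clip t| <= 1.
Proof. by rewrite ler_norml; case: (clipE t) => -[h1 ->]; lra. Qed.

(** Equality for |t| <= 2; beyond that the right side is 0 and the left side is negative. *)
Lemma clip_even_ge t : 1 - `|t| / 2 <= (clip (1 + t) + clip (1 - t)) / 2.
Proof.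
wlog t0 : t / 0 <= t => [hw|].
  have [/hw //|/ltW t0] := leP 0 t; have := hw (- t).
  by rewrite normrN opprK [clip _ + _]addrC; apply; lra.
rewrite ger0_norm //.
by case: (clipE (1 + t)) (clipE (1 - t)) => -[h1 ->] [] [h2 ->]; lra.
Qed.

(* The constant 8/3125 is the best one: equality holds at [t = 5/2]. *)
Lemma clip_odd_ge t :
  t ^+ 2 / 2 - 8 / 3125 * t ^+ 6 <= (t * clip (1 + t) - t * clip (1 - t)) / 2.
Proof.
wlog t0 : t / 0 <= t => [hw|].
  have [/hw //|/ltW t0] := leP 0 t; have := hw (- t).
  rewrite opprK sqrrN (_ : (- t) ^+ 6 = t ^+ 6); last by ring.
  by move=> h; have := h ltac:(lra); lra.
have t6 : 0 <= t ^+ 6 by rewrite exprn_ge0.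
have -> : clip (1 + t) = 1 by case: (clipE (1 + t)) => -[h1 ->]; lra.
case: (clipE (1 - t)) => -[h2 ->]; [|nra..].
(* For t >= 2 the claim becomes s^5 - 5s + 4 >= 0, which has the factor (s - 1)^2; the scaling moves
   the point of equality to s = 1. *)
pose s := 2 / 5 * t.
have : 0 <= t * ((s - 1) ^+ 2 * (s ^+ 3 + 2 * s ^+ 2 + 3 * s + 4)).
  by rewrite mulr_ge0 // mulr_ge0 ?sqr_ge0 // !addr_ge0 ?mulr_ge0 ?exprn_ge0 //; rewrite /s; lra.
by rewrite /s; lra.
Qed.

Lemma walk_even n (f : R -> R) : walk n f = walk n (fun z => (f z + f (- z)) / 2).
Proof.
transitivity (walk n (fun z => (f z - - f (- z)) / 2)).
  by rewrite walk_half_diff walkN walk_sym; field.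
by apply: eq_walk => z; rewrite opprK.
Qed.

(** The conditional expectation of y_u given x_u = a and x_v = b on an edge uv: one of the N terms
    of S_u equals b, the other N - 1 are free. *)
Definition clip_walk (N : nat) (a b : R) : R :=
  walk N.-1 (fun z => clip (a + (b + z) / Num.sqrt N%:R)).

Lemma clip_walk_corr N : (2 <= N)%N ->
  52 / 100 / Num.sqrt N%:R <= (clip_walk N 1 1 ^+ 2 - clip_walk N 1 (-1) ^+ 2) / 2.
Proof.
move=> N2; pose r : R := Num.sqrt N%:R.
have r0 : 0 < r by rewrite sqrtr_gt0 ltr0n; lia.
have r2 : r ^+ 2 = N%:R by rewrite sqr_sqrtr.
pose f z := clip (1 + z / r).
have f1 z : clip (1 + (1 + z) / r) = f (z + 1) by rewrite /f addrC [1 + z]addrC addrC.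
have f2 z : clip (1 + (-1 + z) / r) = f (z - 1) by rewrite /f [-1 + z]addrC.
have E1 : clip_walk N 1 1 = walk N.-1 (fun z => f (z + 1)).
  by apply: eq_walk => z; rewrite f1.
have E2 : clip_walk N 1 (-1) = walk N.-1 (fun z => f (z - 1)).
  by apply: eq_walk => z; rewrite f2.
have Np : N.-1.+1 = N by rewrite prednK //; lia.
set p1 := clip_walk N 1 1 in E1 *; set p2 := clip_walk N 1 (-1) in E2 *.
(* The half-sum and half-difference of [p1] and [p2] are the correlations p and q, and the goal is a
   bound on 2 p q. Averaging over b restores the N-th step, which gives p; Stein's identity gives
   q. *)
have P : (p1 + p2) / 2 = walk N f by rewrite E1 E2 -[in RHS]Np.
have Q : N%:R * ((p1 - p2) / 2) = walk N (fun z => z * f z).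
  by rewrite E1 E2 -walk_half_diff -[in RHS]Np walk_stein Np.
have hP : 1 - walk N Num.norm / r / 2 <= (p1 + p2) / 2.
  rewrite P [walk N f]walk_even.
  have -> : 1 - walk N Num.norm / r / 2 = walk N (fun z => 1 + (- (r^-1 / 2)) * `|z|).
    by rewrite walkD walk_cst walkZ; field; lra.
  apply: le_walk => z; have := clip_even_ge (z / r).
  rewrite /f !mulNr normrM [`|r^-1|]ger0_norm ?invr_ge0 ?(ltW r0) //.
  by move=> h; apply: le_trans h; lra.
(* 120/3125 is the sixth-moment factor 15 times the 8/3125 of [clip_odd_ge]. *)
have hQ : (1 / 2 - 120 / 3125) * r <= N%:R * ((p1 - p2) / 2).
  have [b hb] : exists b : R, b = 8 / 3125 by exists (8 / 3125).
  have -> : 1 / 2 - 120 / 3125 = 1 / 2 - 15 * b by rewrite hb; lra.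
  rewrite Q walk_even.
  apply: (@le_trans _ _ (walk N (fun z => r^-1 / 2 * z ^+ 2
                                        + (- (b / r ^+ 5)) * z ^+ 6))).
    rewrite walkD !walkZ walk_sqr.
    have := walk_exp6 R N; rewrite -r2 -exprM => h6.
    have : b / r ^+ 5 * walk N (fun z => z ^+ 6) <= b / r ^+ 5 * (15 * r ^+ 6).
      by rewrite ler_wpM2l // divr_ge0 ?exprn_ge0 ?(ltW r0) //; rewrite hb; lra.
    have -> : b / r ^+ 5 * (15 * r ^+ 6) = 15 * b * r by field; lra.
    have -> : r^-1 / 2 * r ^+ 2 = r / 2 by field; lra.
    by rewrite mulNr; lra.
  apply: le_walk => z; have := clip_odd_ge (z / r); rewrite -hb.
  move/(ler_wpM2l (ltW r0)); rewrite /f.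
  set u := clip (1 + z / r); rewrite [- z / r]mulNr; set v := clip (1 - z / r).
  have -> : r * ((z / r * u - z / r * v) / 2) = (z * u + - z * v) / 2 by field; lra.
  by move=> h; apply: le_trans h; rewrite le_eqVlt; apply/orP; left; apply/eqP; field; lra.
have hE := walk_norm_le R N2; rewrite -r2 in hE.
have e0 := walk_norm_ge0 R N.
set e := walk N Num.norm in hP hE e0.
(* 0.87 is slightly above sqrt 3 / 2, and 1 - 0.87/2 is the 113/200 used for p below. *)
have hE' : e / r <= 87 / 100.
  rewrite ler_pdivrMr // -ler_sqr ?nnegrE //; last by rewrite mulr_ge0 ?(ltW r0) //; lra.
  by rewrite exprMn; apply: le_trans hE _; rewrite ler_wpM2r ?sqr_ge0 //; lra.
have hQ' : 461 / 1000 / r <= (p1 - p2) / 2.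
  rewrite ler_pdivrMr // -(ler_pM2r r0) -[leRHS]mulrA -expr2 r2 [leRHS]mulrC.
  by apply: le_trans hQ; rewrite ler_pM2r //; lra.
have -> : (p1 ^+ 2 - p2 ^+ 2) / 2 = 2 * ((p1 + p2) / 2) * ((p1 - p2) / 2) by field.
(* 2 * 0.565 * 0.461 = 0.52093. *)
apply: (@le_trans _ _ (2 * (113 / 200) * (461 / 1000 / r))).
  by rewrite [leRHS]mulrA ler_wpM2r ?invr_ge0 ?(ltW r0) //; lra.
by apply: ler_pM; [lra| |lra|exact: hQ']; apply: divr_ge0; lra.
Qed.

Lemma clip_walkN N a b : clip_walk N (- a) (- b) = - clip_walk N a b.
Proof.
rewrite /clip_walk -walk_sym -walkN; apply: eq_walk => z.
by rewrite -clipN; congr clip; rewrite -opprD mulNr opprD.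
Qed.

End Clip.

(** * The modularity score of a bipartition as a quadratic form in signs *)

Section Cut.
Variables (R : realType) (V : finType) (G : sgraph V).
Implicit Types (A : {set V}) (u v : V) (x y : V -> R).

Lemma double_edges_in A :
  (edges_in G A * 2 = \sum_(u in A) \sum_(v in A) adj G u v)%N.
Proof.
pose P := [set p : V * V | [&& p.1 \in A, p.2 \in A & adj G p.1 p.2]].
have -> : (\sum_(u in A) \sum_(v in A) adj G u v = \sum_(p in P) 1)%N.
  rewrite pair_big /= [RHS]big_mkcond [LHS]big_mkcond; apply: eq_bigr => p _.
  by rewrite inE andbA; case: (_ && _) => //=; case: adj.
pose h (p : V * V) := [set p.1; p.2].
rewrite (partition_big h (mem [set E in edges G | E \subset A])) /=; last first.
  move=> p; rewrite !inE => /and3P[p1 p2 ap]; apply/andP; split.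
    by apply: imset_f; rewrite inE.
  by apply/fintype.subsetP => w; rewrite !inE => /orP[] /eqP ->.
rewrite /edges_in -sum1_card big_distrl /=; apply: eq_bigr => E.
rewrite inE => /andP[/imsetP[[a b]]]; rewrite inE /= => ab -> sA.
have anb : a != b by apply: contraTneq ab => ->; rewrite adj_irrefl.
have aA : a \in A by apply: (fintype.subsetP sA); rewrite !inE eqxx.
have bA : b \in A by apply: (fintype.subsetP sA); rewrite !inE eqxx orbT.
(* The fibre over an edge consists of two ordered pairs, distinct because there are no loops. *)
rewrite sum1dep_card -[LHS](_ : #|[set (a, b); (b, a)]| = _); last first.
  by rewrite cards2 xpair_eqE (negbTE anb).
apply: eq_card => -[c d]; rewrite !inE /= !xpair_eqE.
apply/idP/idP.
  case/orP => /andP[/eqP -> /eqP ->]; rewrite ?aA ?bA ?ab ?eqxx //.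
  by rewrite adj_sym ab /= finset.setUC eqxx.
case/andP => /and3P[_ _ cd] /eqP e.
have cnd : c != d by apply: contraTneq cd => ->; rewrite adj_irrefl.
have : c \in [set a; b] by rewrite -e !inE eqxx.
have : d \in [set a; b] by rewrite -e !inE eqxx orbT.
rewrite !inE => /orP[] /eqP dE /orP[] /eqP cE; move: cnd; rewrite cE dE ?eqxx //.
by rewrite orbT.
Qed.

Lemma sum_indicator A (F : V -> R) : \sum_(v in A) F v = \sum_v F v * (v \in A)%:R.
Proof.
by rewrite big_mkcond; apply: eq_bigr => v _; case: (v \in A); rewrite ?mulr1 ?mulr0.
Qed.

Lemma edges_inE A : 2 * (edges_in G A)%:R
  = \sum_u \sum_v (adj G u v)%:R * ((u \in A)%:R * (v \in A)%:R) :> R.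
Proof.
rewrite mulrC -natrM double_edges_in natr_sum sum_indicator; apply: eq_bigr => u _.
rewrite natr_sum sum_indicator mulr_suml; apply: eq_bigr => v _.
by rewrite mulrAC -!mulrA mulrCA mulrA.
Qed.

Lemma degE v : (deg G v)%:R = \sum_w (adj G v w)%:R :> R.
Proof.
by rewrite /deg -sum1dep_card natr_sum big_mkcond; apply: eq_bigr => w _; case: adj.
Qed.

Lemma volE A : (vol G A)%:R = \sum_v (deg G v)%:R * (v \in A)%:R :> R.
Proof. by rewrite /vol natr_sum sum_indicator. Qed.

Lemma edges_in_setT : edges_in G [set: V] = num_edges G.
Proof. by apply: eq_card => E; rewrite !inE finset.subsetT andbT. Qed.

Lemma handshake : \sum_v (deg G v)%:R = 2 * (num_edges G)%:R :> R.
Proof.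
rewrite -edges_in_setT edges_inE; apply: eq_bigr => v _; rewrite degE.
by apply: eq_bigr => w _; rewrite !inE !mulr1.
Qed.

Definition part_score A : R :=
  (edges_in G A)%:R / (num_edges G)%:R
  - ((vol G A)%:R / (2 * (num_edges G)%:R)) ^+ 2.

Lemma modularity_ge_bipart A : (0 < #|V|)%N ->
  part_score A + part_score (~: A) <= modularity R G.
Proof.
move=> V0; set s := part_score.
have s0 : s finset.set0 = 0.
  rewrite /s /part_score /vol big_set0 mul0r expr0n subr0.
  rewrite [edges_in _ _](_ : _ = 0%N) ?mul0r //; apply/eqP.
  rewrite cards_eq0; apply/eqP/finset.setP => E; rewrite !inE finset.subset0.
  apply/negP => /andP[/imsetP[p _ ->]] /eqP /finset.setP /(_ p.1).
  by rewrite !inE eqxx.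
have AnA : A != ~: A.
  apply/eqP => /finset.setP e; case/card_gt0P: V0 => v _.
  by have := e v; rewrite inE; case: (v \in A).
pose P := [set A; ~: A] :\ finset.set0.
have pP : finset.partition P [set: V].
  apply/and3P; split.
  - apply/eqP/finset.setP => v; rewrite inE; apply/bigcupP.
    case: (boolP (v \in A)) => vA; [exists A|exists (~: A)]; rewrite ?inE //.
    + by rewrite eqxx andbT; apply/finset.set0Pn; exists v.
    + by rewrite eqxx orbT andbT; apply/finset.set0Pn; exists v; rewrite inE.
  - apply/finset.trivIsetP => B C; rewrite !inE.
    move=> /andP[_ /orP[]/eqP ->] /andP[_ /orP[]/eqP ->]; rewrite ?eqxx // => _.
      by rewrite -finset.setI_eq0 finset.setICr.
    by rewrite disjoint_sym -finset.setI_eq0 finset.setICr.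
  - by rewrite !inE eqxx.
have -> : s A + s (~: A) = mod_score R G P; last exact: modularity_ge.
rewrite -[RHS]/(\sum_(B in P) s B).
transitivity (\sum_(B in [set A; ~: A]) s B).
  by rewrite big_setU1 ?inE //= big_set1.
have [h|h] := boolP (finset.set0 \in [set A; ~: A]).
  by rewrite (big_setD1 _ h) /= s0 add0r.
by rewrite /P (finset.setDidPl _) // disjoint_sym disjoints1.
Qed.

(** With 1_A = (1 + x)/2, the two parts contain m/2 + S/4 edges in total and have volumes m + X/2
    and m - X/2; the constant terms 1/2 cancel. *)
Lemma modularity_ge_signs x : (0 < num_edges G)%N ->
  (forall v, x v = 1 \/ x v = -1) ->
  (\sum_u \sum_v (adj G u v)%:R * (x u * x v)
     - (\sum_v (deg G v)%:R * x v) ^+ 2 / (2 * (num_edges G)%:R))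
  / (4 * (num_edges G)%:R) <= modularity R G.
Proof.
move=> m0 x1; set m : R := (num_edges G)%:R.
have mp : 0 < m by rewrite ltr0n.
have V0 : (0 < #|V|)%N.
  have : (0 < #|edges G|)%N by [].
  by case/card_gt0P => E /imsetP[p _ _]; apply/card_gt0P; exists p.1.
pose A := [set v | x v == 1].
have inA v : (v \in A)%:R = (1 + x v) / 2 :> R.
  rewrite inE; case: (x1 v) => ->; first by rewrite eqxx /=; field.
  by rewrite (_ : (-1 == 1 :> R) = false) /=; [field | apply/eqP; lra].
have inCA v : (v \in ~: A)%:R = (1 - x v) / 2 :> R.
  rewrite inE -[_ \notin _]negbK; have := inA v; case: (v \in A) => /=; lra.
set S := \sum_u \sum_v _; set X := \sum_v _.
have hE : 2 * ((edges_in G A)%:R + (edges_in G (~: A))%:R) = (2 * m + S) / 2.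
  rewrite mulrDr !edges_inE -big_split /= -handshake -big_split /= mulr_suml.
  apply: eq_bigr => u _; rewrite degE -!big_split /= mulr_suml.
  by apply: eq_bigr => v _; rewrite !inA !inCA; field.
have hA : (vol G A)%:R = (2 * m + X) / 2.
  rewrite volE -handshake -big_split /= mulr_suml.
  by apply: eq_bigr => v _; rewrite inA; field.
have hC : (vol G (~: A))%:R = (2 * m - X) / 2.
  rewrite volE -handshake -sumrB mulr_suml.
  by apply: eq_bigr => v _; rewrite inCA; field.
apply: le_trans (modularity_ge_bipart A V0); rewrite /part_score -/m hA hC.
have -> : (edges_in G A)%:R = (2 * m + S) / 4 - (edges_in G (~: A))%:R by lra.
by rewrite le_eqVlt; apply/orP; left; apply/eqP; field; lra.
Qed.

End Cut.

(** * From random and fractional vectors to signs *)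

Section Rounding.
Variables (R : realType) (V : finType) (G : sgraph V).
Implicit Types (u v w : V) (x y : V -> R).

Lemma upd_id x v : upd x v (x v) = x.
Proof. by apply/funext => w; rewrite /upd; case: eqP => // ->. Qed.

(** As |x v| <= 1, [f x] is a convex combination of its values with x v set to 1 and to -1, so one
    of these does not decrease [f]; coordinates are rounded one at a time. *)
Lemma round_signs (f : (V -> R) -> R) y :
  (forall x v t,
     f (upd x v t) = (1 + t) / 2 * f (upd x v 1) + (1 - t) / 2 * f (upd x v (-1))) ->
  (forall v, `|y v| <= 1) ->
  exists2 x, forall v, x v = 1 \/ x v = -1 & f y <= f x.
Proof.
move=> aff y1.
suff [x [xs _ fx]] : exists x, [/\ forall v, v \in enum V -> x v = 1 \/ x v = -1,
    forall v, `|x v| <= 1 & f y <= f x].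
  by exists x => // v; apply: xs; rewrite mem_enum.
elim: (enum V) => [|v s [x [xs x1 fx]]]; first by exists y.
have [t t1 ft] : exists2 t, t = 1 \/ t = -1 & f x <= f (upd x v t).
  have := aff x v (x v); rewrite upd_id => e.
  have := x1 v; rewrite ler_norml => xv.
  have [h|h] := lerP (f (upd x v 1)) (f (upd x v (-1))).
    by exists (-1); [by right|]; rewrite e; nra.
  by exists 1; [by left|]; rewrite e; nra.
exists (upd x v t); split; last exact: le_trans ft.
- move=> w; rewrite inE /upd; case: eqP => //= _; exact: xs.
- move=> w; rewrite /upd; case: eqP => // _.
  by case: t1 => ->; rewrite ?normrN normr1.
Qed.

Lemma sum_sqr_deg_le :
  \sum_v (deg G v)%:R ^+ 2 <= (max_deg G)%:R * (2 * (num_edges G)%:R) :> R.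
Proof.
rewrite -handshake big_distrr /=; apply: ler_sum => v _.
by rewrite expr2 ler_wpM2r // ler_nat /max_deg (bigD1 v) //= leq_maxl.
Qed.

Lemma modularity_ge_fractional y : (0 < num_edges G)%N ->
  (forall v, `|y v| <= 1) ->
  (\sum_u \sum_v (adj G u v)%:R * (y u * y v)
     - (\sum_v (deg G v)%:R * y v) ^+ 2 / (2 * (num_edges G)%:R) - (max_deg G)%:R)
  / (4 * (num_edges G)%:R) <= modularity R G.
Proof.
move=> m0 y1; set m : R := (num_edges G)%:R.
have mp : 0 < m by rewrite ltr0n.
pose d v : R := (deg G v)%:R.
(* Removing the diagonal makes the form affine in each coordinate. The removed part, the sum of
   d_v^2 x_v^2 / 2m, lies between 0 and the maximum degree. *)
pose f x := \sum_u \sum_v ((adj G u v)%:R - d u * d v / (2 * m))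
                            * (if u == v then 0 else x u * x v).
have fE x : f x = \sum_u \sum_v (adj G u v)%:R * (x u * x v)
    - (\sum_v d v * x v) ^+ 2 / (2 * m) + (\sum_v d v ^+ 2 * x v ^+ 2) / (2 * m).
  rewrite expr2 !mulr_suml -sumrB -big_split /=; apply: eq_bigr => u _.
  rewrite mulr_sumr mulr_suml -sumrB.
  rewrite (bigD1 u) //= [in RHS](bigD1 u) //= eqxx adj_irrefl mulr0n.
  rewrite [X in _ + X = _](eq_bigr (fun v => (adj G u v)%:R * (x u * x v)
            - d u * x u * (d v * x v) / (2 * m))); first by field; lra.
  by move=> v /negbTE vu; rewrite eq_sym vu; field; lra.
have [||x x1 fx] := @round_signs f y => //.
  move=> x v t; rewrite /f !mulr_sumr -big_split; apply: eq_bigr => u _ /=.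
  rewrite !mulr_sumr -big_split; apply: eq_bigr => w _ /=.
  rewrite /upd; case: (eqVneq u w) => [->|uw]; first by field; lra.
  case: (eqVneq u v) => [uv|uv]; last by case: (eqVneq w v) => wv; field; lra.
  by rewrite -uv eq_sym (negbTE uw); field; lra.
apply: le_trans (modularity_ge_signs m0 x1); rewrite -/m.
rewrite ler_pM2r ?invr_gt0 ?mulr_gt0 //.
move: fx; rewrite !fE => fx.
have h1 : 0 <= (\sum_v d v ^+ 2 * y v ^+ 2) / (2 * m).
  rewrite divr_ge0 //; last lra.
  by apply: sumr_ge0 => v _; rewrite mulr_ge0 // sqr_ge0.
have h2 : (\sum_v d v ^+ 2 * x v ^+ 2) / (2 * m) <= (max_deg G)%:R.
  rewrite ler_pdivrMr ?mulr_gt0 //; apply: le_trans (sum_sqr_deg_le).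
  by apply: ler_sum => v _; case: (x1 v) => ->; rewrite ?sqrrN expr1n mulr1.
rewrite -/d; lra.
Qed.

(** Every coordinate of the base point is overwritten; 0 is chosen because it is its own negative,
    as [avg_odd0] requires. *)
Definition mean (f : (V -> R) -> R) : R := avg (enum V) f (fun=> 0).

(** Oddness centres d.Y, and by locality flipping one sign moves it by at most 2K, so its variance
    is at most |V| K^2. Some sign vector then does at least as well as the mean. *)
Lemma modularity_ge_random (Y : (V -> R) -> V -> R) (N : V -> {set V}) (K : R) :
  (0 < num_edges G)%N ->
  (forall x v, `|Y x v| <= 1) ->
  (forall x v, Y (fun w => - x w) v = - Y x v) ->
  (forall x v w t, v \notin N w -> Y (upd x w t) v = Y x v) ->
  (forall w, \sum_(v in N w) (deg G v)%:R <= K) ->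
  (\sum_u \sum_v (adj G u v)%:R * mean (fun x => Y x u * Y x v)
     - #|V|%:R * K ^+ 2 / (2 * (num_edges G)%:R) - (max_deg G)%:R)
  / (4 * (num_edges G)%:R) <= modularity R G.
Proof.
move=> m0 Y1 YN Yloc NK; set m : R := (num_edges G)%:R.
have mp : 0 < m by rewrite ltr0n.
pose S x := \sum_v (deg G v)%:R * Y x v.
have varS : mean (fun x => S x ^+ 2) <= #|V|%:R * K ^+ 2.
  have S0 : mean S = 0.
    apply: avg_odd0 => x; rewrite /S -sumrN; apply: eq_bigr => v _.
    by rewrite YN mulrN.
  have := @efron_stein R V (enum V) S (fun=> 2 * K) (fun=> 0) (enum_uniq V).
  rewrite -/(mean S) S0 expr0n add0r -/(mean _) => /(_ _)/le_trans; apply.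
    move=> w x _; rewrite /S -sumrB (bigID (mem (N w))) /= [X in _ + X]big1 ?addr0; last first.
      by move=> v vN; rewrite !Yloc ?subrr.
    apply: le_trans (ler_norm_sum _ _ _) _.
    apply: (@le_trans _ _ (\sum_(v in N w) 2 * (deg G v)%:R)).
      apply: ler_sum => v _; rewrite -mulrBr normrM ger0_norm // mulrC ler_wpM2r //.
      apply: le_trans (ler_normB _ _) _.
      by have := Y1 (upd x w 1) v; have := Y1 (upd x w (-1)) v; lra.
    by rewrite -mulr_sumr ler_wpM2l.
  rewrite big_const_seq count_predT -cardE iter_addr_0 -mulr_natl.
  by rewrite le_eqVlt; apply/orP; left; apply/eqP; field.
pose Q x := (\sum_u \sum_v (adj G u v)%:R * (Y x u * Y x v)
     + (- (2 * m)^-1) * S x ^+ 2 + - (max_deg G)%:R).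
have [x Qx] := avg_attained (enum V) Q (fun=> 0).
have QE : mean Q = \sum_u \sum_v (adj G u v)%:R * mean (fun x => Y x u * Y x v)
     - mean (fun x => S x ^+ 2) / (2 * m) - (max_deg G)%:R.
  rewrite /mean !avgD avg_cst avgZ avg_sum mulNr [_ / (2 * m)]mulrC; congr (_ - _ - _).
  by apply: eq_bigr => u _; rewrite avg_sum; apply: eq_bigr => v _; rewrite avgZ.
apply: le_trans (modularity_ge_fractional m0 (Y1 x)); rewrite -/m.
rewrite ler_pM2r ?invr_gt0 ?mulr_gt0 //.
move: Qx; rewrite -/(mean Q) QE /Q -/(S x) mulNr [_ * S x ^+ 2]mulrC.
have : mean (fun x => S x ^+ 2) / (2 * m) <= #|V|%:R * K ^+ 2 / (2 * m).
  by rewrite ler_pM2r // invr_gt0 mulr_gt0.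
lra.
Qed.

End Rounding.

(** * Correlated random values on the low-degree vertices *)

Section Correlated.
Variables (R : realType) (V : finType) (G : sgraph V) (L : {set V}).
Implicit Types (u v w : V) (x y : V -> R).

(** Turns an average over sign vectors into a random walk: only the number of resampled coordinates
    in [A] matters. *)
Lemma avg_walk (A : {set V}) u (h : R -> R -> R) s x : uniq s -> u \notin s ->
  avg s (fun y => h (y u) (\sum_(w in A) y w)) x =
  walk (count (mem A) s) (fun z => h (x u) (\sum_(w in A | w \notin s) x w + z)).
Proof.
elim: s x => [|v s IH] x /=.
  by move=> _ _; rewrite addr0; congr h; apply: eq_bigl => w; rewrite andbT.
move=> /andP[vs us]; rewrite inE negb_or => /andP[uv us'].
rewrite !IH // {1 3}/upd (negbTE uv).
have sumE t : \sum_(w in A | w \notin s) upd x v t w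
    = (if v \in A then t else 0) + \sum_(w in A | w \notin v :: s) x w.
  have off w : (w \in A) && (w \notin v :: s) = [&& w \in A, w \notin s & w != v].
    by rewrite inE negb_or [(_ != _) && _]andbC.
  rewrite (eq_bigl _ _ off); case: ifP => vA.
    rewrite (bigD1 v) ?vA //= {1}/upd eqxx; congr (_ + _).
    by rewrite (eq_bigl _ _ (fun w => esym (andbA _ _ _))); apply: eq_big => [w|w];
       rewrite ?andbA // /upd => /andP[_ /negbTE ->].
  rewrite add0r; apply: eq_big => [w|w].
    by case: (eqVneq w v) => [->|]; rewrite ?vA ?andbT.
  by rewrite /upd; case: eqP => // ->; rewrite vA.
rewrite !sumE; case: (v \in A); last first.
  by rewrite add0n add0r; field.
rewrite add1n walkS; congr ((_ + _) / _); apply: eq_walk => z; congr h; ring.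
Qed.

Lemma card_count (A : {set V}) : #|A| = count (mem A) (enum V).
Proof. by rewrite -sum1_card -sum1_count enumT. Qed.

Definition nbr v := [set w in L | adj G v w].

(* The vertices of [L] whose random value may depend on the coordinate [w]. *)
Definition zone w := [set v in L | (w \in L) && ((v == w) || adj G w v)].

(** [corr_odd] and [corr_local] control the variance of d.y, [corr_out] cancels the edges that leave
    [L], and [corr_adj] is the gain on the edges inside. *)
Record correlated (tau : R) (Y : (V -> R) -> V -> R) : Prop := Correlated {
  corr_bound : forall x v, `|Y x v| <= 1;
  corr_odd : forall x v, Y (fun w => - x w) v = - Y x v;
  corr_out : forall x v, v \notin L -> Y x v = 0;
  corr_local : forall x v w t, v \notin zone w -> Y (upd x w t) v = Y x v;
  corr_adj : forall u v, u \in L -> v \in L -> adj G u v ->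
    tau <= mean (fun x => Y x u * Y x v)
}.

(* The inner walk pads the degree of [v] inside [L] up to exactly [N]. *)
Definition tilt (N : nat) x v : R :=
  if v \in L then
    walk (N - #|nbr v|)
      (fun z => clip (x v + (\sum_(w in nbr v) x w + z) / Num.sqrt N%:R))
  else 0.

Lemma avg_tilt N u v s x : u \in L -> v \in nbr u -> (#|nbr u| <= N)%N ->
  perm_eq (enum V) [:: u, v & s] ->
  avg s (fun y => tilt N y u) x = clip_walk N (x u) (x v).
Proof.
move=> uL vu dN ps; have := perm_uniq ps; rewrite enum_uniq /= inE negb_or.
move/esym/and3P => [/andP[uv us] vs s_uniq].
have uu : u \notin nbr u by rewrite inE adj_irrefl andbF.
rewrite /tilt uL (avg_walk _ (fun a b => walk _ (fun z => clip (a + (b + z) / _)))) //.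
have -> : \sum_(w in nbr u | w \notin s) x w = x v.
  rewrite (big_pred1 v) // => w /=; case: (eqVneq w v) => [->|wv].
    by rewrite vu vs.
  apply/negP => /andP[wu ws].
  have : w \in enum V by rewrite mem_enum.
  rewrite (perm_mem ps) !inE (negbTE wv) (negbTE ws) !orbF => /eqP wu'.
  by rewrite wu' (negbTE uu) in wu.
have c : #|nbr u| = (count (mem (nbr u)) s).+1.
  by rewrite card_count (permP ps) /= (negbTE uu) vu add0n add1n.
rewrite /clip_walk.
(* The neighbours of [u] other than [v], together with the padding, make N - 1 free steps. *)
have -> : N.-1 = (count (mem (nbr u)) s + (N - #|nbr u|))%N by lia.
rewrite -walk_walk; apply: eq_walk => z; apply: eq_walk => t.
by rewrite addrA.
Qed.

Lemma tilt_mono N v : pointwise_mono (fun x => tilt N x v).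
Proof.
move=> x y xy; rewrite /tilt; case: ifP => // _.
apply: le_walk => z; apply: le_clip; rewrite lerD // ler_wpM2r ?invr_ge0 ?sqrtr_ge0 //.
by rewrite lerD2r; apply: ler_sum.
Qed.

(** Conditionally on the signs at [u] and [v], Harris bounds the mean product below by a product of
    means. Equal signs give p1^2 and opposite signs -p2^2 by oddness, hence (p1^2 - p2^2)/2 on
    average. *)
Lemma tilt_corr N u v : (2 <= N)%N -> (forall w, w \in L -> (#|nbr w| <= N)%N) ->
  u \in L -> v \in L -> adj G u v ->
  52 / 100 / Num.sqrt N%:R <= mean (fun x => tilt N x u * tilt N x v).
Proof.
move=> N2 dN uL vL uv; apply: le_trans (clip_walk_corr R N2) _.
have vu : v \in nbr u by rewrite inE vL uv.
have uv' : u \in nbr v by rewrite inE uL adj_sym uv.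
have anb : v != u by apply: contraTneq uv => ->; rewrite adj_irrefl.
have ue : u \in enum V by rewrite mem_enum.
have ve : v \in rem u (enum V) by rewrite mem_rem_uniq ?enum_uniq // !inE anb mem_enum.
pose s := rem v (rem u (enum V)).
have ps : perm_eq (enum V) [:: u, v & s].
  apply: perm_trans (perm_to_rem ue) _; rewrite perm_cons; exact: perm_to_rem.
have ps' : perm_eq (enum V) [:: v, u & s].
  apply: perm_trans ps _; apply/permP => a /=; lia.
have key a b : clip_walk N a b * clip_walk N b a
    <= avg s (fun x => tilt N x u * tilt N x v) (upd (upd (fun=> 0) u a) v b).
  apply: le_trans (harris _ _ (tilt_mono N u) (tilt_mono N v)).
  rewrite (avg_tilt _ uL vu (dN _ uL) ps) (avg_tilt _ vL uv' (dN _ vL) ps').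
  by rewrite /upd !eqxx eq_sym (negbTE anb).
rewrite /mean (avg_rem _ _ ue) /= !(avg_rem _ _ ve) /= -/s.
have := key 1 1; have := key 1 (-1); have := key (-1) 1; have := key (-1) (-1).
have := clip_walkN N (1 : R) 1; have := clip_walkN N (1 : R) (-1); rewrite opprK => -> ->.
rewrite !expr2; lra.
Qed.

Lemma correlated_tilt N : (2 <= N)%N -> (forall w, w \in L -> (#|nbr w| <= N)%N) ->
  correlated (52 / 100 / Num.sqrt N%:R) (tilt N).
Proof.
move=> N2 dN; split.
- move=> x v; rewrite /tilt; case: ifP => _; last by rewrite normr0.
  rewrite ler_norml; apply/andP; split.
    rewrite -(walk_cst (N - #|nbr v|) (-1)); apply: le_walk => z.
    by have := norm_clip (x v + (\sum_(w in nbr v) x w + z) / Num.sqrt N%:R);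
       rewrite ler_norml => /andP[].
  rewrite -[leRHS](walk_cst (N - #|nbr v|)); apply: le_walk => z.
  by have := norm_clip (x v + (\sum_(w in nbr v) x w + z) / Num.sqrt N%:R);
     rewrite ler_norml => /andP[].
- move=> x v; rewrite /tilt; case: ifP => _; last by rewrite oppr0.
  rewrite -walk_sym -walkN; apply: eq_walk => z.
  by rewrite sumrN -clipN; congr clip; rewrite -opprD mulNr -opprD.
- by move=> x v /negbTE vL; rewrite /tilt vL.
- move=> x v w t; rewrite inE /tilt; case: ifP => //= vL wv.
  have vw : v != w by apply: contraNneq wv => <-; rewrite vL eqxx.
  apply: eq_walk => z; congr clip; congr (_ + (_ + _) / _).
    by rewrite /upd (negbTE vw).
  apply: eq_bigr => a; rewrite inE /upd => /andP[aL va]; case: eqP => // aw.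
  by move: wv; rewrite -aw aL adj_sym va orbT.
- by move=> u v; exact: tilt_corr.
Qed.

Definition nbhd v := [set w in L | (w == v) || adj G v w].

(** The choice depends only on the set [nbhd v], so vertices of [L] with the same closed
    neighbourhood in [L] share it; for these the default [v] is never reached. *)
Definition rep v := odflt v [pick w in nbhd v].

Lemma rep_in v : v \in L -> rep v \in nbhd v.
Proof.
move=> vL; rewrite /rep; case: pickP => [//|/(_ v)].
by rewrite inE vL eqxx.
Qed.

(** Adjacent vertices of [L] have the same closed neighbourhood in [L], hence the same
    representative. [clip] fixes signs and keeps the bound valid for arbitrary real [x]. *)
Lemma correlated_rep : (forall w, w \in L -> (#|nbr w| <= 1)%N) ->
  correlated 1 (fun x v => if v \in L then clip (x (rep v)) else 0).
Proof.
move=> d1; split.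
- by move=> x v; case: ifP => _; rewrite ?norm_clip ?normr0.
- by move=> x v; case: ifP => _; rewrite ?clipN ?oppr0.
- by move=> x v /negbTE ->.
- move=> x v w t; rewrite inE; case: ifP => //= vL wv; rewrite /upd; case: eqP => // rw.
  have := rep_in vL; rewrite rw inE => /andP[wL h].
  by move: wv; rewrite wL eq_sym adj_sym h.
move=> u v uL vL uv; rewrite uL vL.
have nbr1 a b : a \in L -> b \in L -> adj G a b -> nbhd a = [set a; b].
  move=> aL bL ab.
  have bn : b \in nbr a by rewrite inE bL.
  have e : nbr a = [set b].
    by apply/esym/eqP; rewrite eqEcard finset.sub1set bn cards1 d1.
  apply/finset.setP => w; have := congr1 (fun S : {set V} => w \in S) e.
  rewrite !inE; case: (eqVneq w a) => [->|_]; first by rewrite aL.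
  by move=> /= ->.
have -> : rep u = rep v.
  have e : nbhd u = nbhd v.
    by rewrite (nbr1 u v) // (nbr1 v u) // 1?adj_sym // finset.setUC.
  have := rep_in uL; have := rep_in vL; rewrite /rep e.
  by case: pickP => //= h; rewrite h.
set w := rep v.
have we : w \in enum V by rewrite mem_enum.
have ws : w \notin rem w (enum V) by rewrite mem_rem_uniq ?enum_uniq // !inE eqxx.
rewrite /mean (avg_rem _ _ we) /=.
(* Only the coordinate [w] matters, so the empty set serves and the walk integrates a constant. *)
rewrite !(avg_walk finset.set0 (fun a _ => clip a * clip a)) ?rem_uniq ?enum_uniq //.
rewrite !walk_cst /upd eqxx clipN.
have -> : clip 1 = 1 :> R by case: (clipE (1 : R)) => -[h ->]; lra.
lra.
Qed.

Lemma correlated_weaken tau tau' Y : tau' <= tau -> correlated tau Y -> correlated tau' Y.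
Proof.
move=> le [h1 h2 h3 h4 h5]; split => // u v uL vL uv.
exact: le_trans (h5 _ _ uL vL uv).
Qed.

Lemma exists_correlated (D : R) : 1 < D -> (forall v, v \in L -> (deg G v)%:R < D) ->
  exists Y, correlated (52 / 100 / Num.sqrt D) Y.
Proof.
move=> D1 dD; pose N := \max_(v in L) #|nbr v|.
have dN w : w \in L -> (#|nbr w| <= N)%N by move=> wL; rewrite /N (bigD1 w) //= leq_maxl.
have nbr_deg v : (#|nbr v| <= deg G v)%N.
  by apply/subset_leq_card/fintype.subsetP => w; rewrite !inE => /andP[].
have ND : N%:R < D.
  rewrite /N; elim/big_ind: _ => [|a b ha hb|v vL]; first lra.
    by rewrite /maxn; case: ifP.
  by apply: le_lt_trans (dD _ vL); rewrite ler_nat.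
have sD : 1 <= Num.sqrt D by rewrite -sqrtr1 ler_wsqrtr ?ltW.
have [N2|N1] := leqP 2 N.
  exists (tilt N); apply: correlated_weaken (correlated_tilt N2 dN).
  rewrite ler_pM2l; last lra.
  rewrite lef_pV2 ?posrE ?sqrtr_gt0 ?ltr0n; [|lra|lia].
  by rewrite ler_wsqrtr // ltW.
have d1 w (wL : w \in L) : (#|nbr w| <= 1)%N by apply: leq_trans (dN w wL) _; lia.
exists (fun x v => if v \in L then clip (x (rep v)) else 0).
apply: correlated_weaken (correlated_rep d1).
by rewrite ler_pdivrMr; lra.
Qed.

Lemma card_zone w : (#|zone w| <= (deg G w).+1)%N.
Proof.
rewrite -add1n -(cards1 w) /deg.
apply: leq_trans (leq_card_setU [set w] [set v | adj G w v]).1.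
by apply/subset_leq_card/fintype.subsetP => v; rewrite !inE => /and3P[].
Qed.

Lemma modularity_ge_low (D g : R) : (0 < num_edges G)%N -> 0 <= g -> 1 < D ->
  (forall v, v \in L -> (deg G v)%:R < D) ->
  (1 + g) * (num_edges G)%:R <= (vol G L)%:R ->
  26 / 100 * g / Num.sqrt D
    - (#|V|%:R * (2 * D ^+ 2) ^+ 2 / (2 * (num_edges G)%:R) + (max_deg G)%:R)
      / (4 * (num_edges G)%:R) <= modularity R G.
Proof.
move=> m0 g0 D1 dD hvol; have [Y [Y1 YN Yout Yloc Yadj]] := exists_correlated D1 dD.
set m : R := (num_edges G)%:R in hvol *.
have mp : 0 < m by rewrite ltr0n.
have sD : 0 < Num.sqrt D by rewrite sqrtr_gt0; lra.
(* At most D + 1 <= 2D vertices, each of degree below D. *)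
have zoneK w : \sum_(v in zone w) (deg G v)%:R <= 2 * D ^+ 2.
  have [wL|wL] := boolP (w \in L); last first.
    rewrite big_pred0; first by rewrite mulr_ge0 ?sqr_ge0.
    by move=> v; rewrite inE (negbTE wL) /= andbF.
  apply: (@le_trans _ _ (\sum_(v in zone w) D)).
    by apply: ler_sum => v; rewrite inE => /andP[vL _]; rewrite ltW ?dD.
  rewrite sumr_const -mulr_natr.
  have : #|zone w|%:R <= (deg G w)%:R + 1 :> R by rewrite natr1 ler_nat card_zone.
  by have := dD w wL; nra.
apply: le_trans (modularity_ge_random m0 Y1 YN Yloc zoneK); rewrite -/m.
set T := 52 / 100 / Num.sqrt D in Yadj.
have T0 : 0 <= T by rewrite /T divr_ge0 // ltW.
have hT : T * (2 * (edges_in G L)%:R)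
    <= \sum_u \sum_v (adj G u v)%:R * mean (fun x => Y x u * Y x v).
  rewrite edges_inE mulr_sumr; apply: ler_sum => u _.
  rewrite mulr_sumr; apply: ler_sum => v _.
  have mean0 F : (forall x, F x = 0) -> mean F = 0.
    by move=> F0; rewrite /mean (_ : F = fun=> 0) ?avg_cst //; apply/funext.
  case: (boolP (u \in L)) => uL; last first.
    by rewrite mean0 ?mul0r ?mulr0 // => x; rewrite (Yout x u) ?mul0r.
  case: (boolP (v \in L)) => vL; last first.
    by rewrite mean0 ?mulr0 // => x; rewrite (Yout x v) ?mulr0.
  case: (boolP (adj G u v)) => uv; rewrite ?mul0r ?mulr0 // !mulr1 mul1r.
  exact: Yadj.
(* The complement of [L] contains m - vol(L) + e(L) edges; as this is nonnegative, e(L) >= vol(L) -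
   m >= g m. *)
have hL : g * m <= (edges_in G L)%:R.
  have : 0 <= 2 * (edges_in G (~: L))%:R :> R by [].
  have -> : 2 * (edges_in G (~: L))%:R
      = 2 * m - 2 * (vol G L)%:R + 2 * (edges_in G L)%:R :> R.
    have volE' : (vol G L)%:R = \sum_u \sum_v (adj G u v)%:R * (u \in L)%:R :> R.
      by rewrite volE; apply: eq_bigr => u _; rewrite degE mulr_suml.
    have volE'' : (vol G L)%:R = \sum_u \sum_v (adj G u v)%:R * (v \in L)%:R :> R.
      rewrite volE' exchange_big /=; apply: eq_bigr => u _; apply: eq_bigr => v _.
      by rewrite adj_sym.
    have -> : 2 * (vol G L)%:R = \sum_u \sum_v (adj G u v)%:R * (u \in L)%:R
                     + \sum_u \sum_v (adj G u v)%:R * (v \in L)%:R :> R.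
      by rewrite -volE' -volE''; ring.
    rewrite -handshake !edges_inE opprD.
    rewrite -!sumrN -!big_split /=; apply: eq_bigr => u _.
    rewrite degE -!sumrN -!big_split /=; apply: eq_bigr => v _.
    by rewrite !inE; case: (u \in L); case: (v \in L) => /=; lra.
  lra.
have hTm : T * (2 * (g * m)) <= T * (2 * (edges_in G L)%:R).
  by rewrite ler_wpM2l // ler_wpM2l.
rewrite -subr_ge0.
have -> : 26 / 100 * g / Num.sqrt D = T * (2 * (g * m)) / (4 * m).
  by rewrite /T; field; lra.
rewrite -!mulrBl divr_ge0 //; last lra.
lra.
Qed.

End Correlated.

(** * Asymptotic form of the bound *)

Local Open Scope classical_set_scope.

(* The hypotheses start at n = 2: a simple graph on at most one vertex cannot
   have average degree at least 1. *)
Theorem theorem1p1 (R : realType) (C gamma : R) (G : forall n : nat, sgraph 'I_n)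
    (C_gt1 : 1 < C) (gamma_gt0 : 0 < gamma)
    (avg_deg_ge1 : forall n : nat, (2 <= n)%N -> 1 <= avg_deg R (G n))
    (vol_low : forall n : nat, (2 <= n)%N ->
       (1 + gamma) * (num_edges (G n))%:R <=
         (vol (G n) (low_deg (G n) C))%:R :> R)
    (max_deg_o : (fun n : nat => (max_deg (G n))%:R / n%:R : R) @ \oo --> (0 : R))
    (avg_deg_o : (fun n : nat => avg_deg R (G n) ^+ 10 / n%:R) @ \oo --> (0 : R)) :
  exists2 eps : nat -> R, eps @ \oo --> (0 : R) &
    forall n : nat, (2 <= n)%N ->
      (26 / 100) * gamma / Num.sqrt (C * avg_deg R (G n)) * (1 + eps n)
        <= modularity R (G n).
Proof.
(* Chosen so that 0.26 gamma K = 2.08 C^5: the 2.08 covers the factor 2 of the error term, and the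
   extra C absorbs sqrt(C d) <= C d. *)
pose K := 8 * C ^+ 5 / gamma.
exists (fun n => - (K * ((max_deg (G n))%:R / n%:R + avg_deg R (G n) ^+ 10 / n%:R))).
  have -> : 0 = - (K * (0 + 0)) :> R by rewrite addr0 mulr0 oppr0.
  by apply: cvgN; apply: cvgM; [exact: cvg_cst | exact: cvgD].
move=> n n2; set d := avg_deg R (G n); set M : R := (max_deg (G n))%:R.
have d1 : 1 <= d := avg_deg_ge1 n n2.
have np : 0 < n%:R :> R by rewrite ltr0n; lia.
have m2 : 2 * (num_edges (G n))%:R = n%:R * d.
  rewrite /d /avg_deg card_ord natr_sum handshake; field; lra.
have m0 : (0 < num_edges (G n))%N.
  by rewrite -(ltr0n R) -(pmulr_rgt0 _ (ltr0n R 2)) m2 mulr_gt0 //; lra.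
have D1 : 1 < C * d by nra.
have dD v : v \in low_deg (G n) C -> (deg (G n) v)%:R < C * d by rewrite inE.
apply: le_trans (modularity_ge_low m0 (ltW gamma_gt0) D1 dD (vol_low n n2)).
have -> : 4 * (num_edges (G n))%:R = 2 * (n%:R * d) by rewrite -m2; ring.
rewrite m2 card_ord -/M mulrDr mulr1 mulrN lerD2l lerN2.
have s1 : 1 <= Num.sqrt (C * d) by rewrite -sqrtr1 ler_wsqrtr ?ltW.
have s2 : Num.sqrt (C * d) <= C * d.
  by rewrite -[leRHS]sqr_sqrtr ?expr2 ?ler_peMr; lra.
have [C1 d0] : 1 <= C ^+ 4 /\ 0 < d by split; [rewrite exprn_ege1 // ltW | lra].
have M0 : 0 <= M by [].
have d72 : d ^+ 2 <= d ^+ 9 by rewrite ler_weXn2l.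
(* The error equals 2 C^4 d^2 / n + M / (2 d n); since d >= 1, d^2 is at most d^9 = d^10 / d. *)
apply: (@le_trans _ _ (2 * C ^+ 4 / d * (M / n%:R + d ^+ 10 / n%:R))).
  have -> : (n%:R * (2 * (C * d) ^+ 2) ^+ 2 / (n%:R * d) + M) / (2 * (n%:R * d))
      = (2 * C ^+ 4 * d ^+ 2 + M / (2 * d)) / n%:R by field; lra.
  have -> : 2 * C ^+ 4 / d * (M / n%:R + d ^+ 10 / n%:R)
      = (2 * C ^+ 4 * d ^+ 9 + 2 * C ^+ 4 * (M / d)) / n%:R by field; lra.
  rewrite ler_pM2r ?invr_gt0 // lerD //.
    by rewrite ler_wpM2l //; lra.
  have -> : M / (2 * d) = 1 / 2 * (M / d) by field; lra.
  by rewrite ler_wpM2r ?divr_ge0 //; lra.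
rewrite [leRHS]mulrA; apply: ler_wpM2r.
  by rewrite addr_ge0 ?divr_ge0 ?exprn_ge0 //; lra.
have -> : 26 / 100 * gamma / Num.sqrt (C * d) * K
    = 208 / 100 * C ^+ 5 / Num.sqrt (C * d) by rewrite /K; field; lra.
apply: (@le_trans _ _ (208 / 100 * C ^+ 5 / (C * d))).
  have -> : 208 / 100 * C ^+ 5 / (C * d) = 208 / 100 * C ^+ 4 / d by field; lra.
  by rewrite ler_wpM2r ?invr_ge0 ?(ltW d0) //; lra.
rewrite ler_wpM2l ?lef_pV2 ?posrE //; try lra.
by rewrite mulr_ge0 ?exprn_ge0 //; lra.
Qed.
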